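(* Let $\mathcal S\subset\mathbb R^n$ be nonempty, closed and convex, let $\mathbb M:\mathbb R^n\to\mathbb R^{n\times n}$ take symmetric positive definite values, and suppose there is a constant $L\ge1$ with $\|\mathbb M(x)\|\le L$ and $\|\mathbb M(x)^{-1}\|\le L$ for all $x\in\mathcal S$. Put $Q(x):=\mathbb M(x)^{-1}$. Then for every $x\in\mathcal S$, $\lambda_{\min}(Q(x))\ge L^{-1}$ and $\lambda_{\max}(Q(x))\le L$, so that for all $z_1,z_2\in\mathbb R^n$, $$\bigl\|P_{\mathcal S,Q(x)}(z_1)-P_{\mathcal S,Q(x)}(z_2)\bigr\|\le L\,\|z_1-z_2\|.$$ If in addition there is a constant $K_M\ge0$ with $\|\mathbb M(x)-\mathbb M(y)\|\le K_M\|x-y\|$ for all $x,y\in\mathcal S$, then $$\bigl\|\mathbb M(x)^{-1}-\mathbb M(y)^{-1}\bigr\|\le L^2K_M\|x-y\|\qquad\text{for all }x,y\in\mathcal S.$$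
   Context: $\|\cdot\|$ is the Euclidean norm on $\mathbb R^n$ and the Euclidean operator norm on matrices; $\lambda_{\min},\lambda_{\max}$ denote extreme eigenvalues of a symmetric matrix. For $Q$ symmetric positive definite, $\|x\|_Q:=\sqrt{x^\top Qx}$ and $P_{\mathcal S,Q}(y):=\operatorname{argmin}_{z\in\mathcal S}\tfrac12\|z-y\|_Q^2$ (exists and is unique). *)

(* Defs.v *)
From mathcomp Require Import all_boot all_order all_algebra.
From mathcomp Require Import all_classical all_reals all_analysis.
Import Order.TTheory GRing.Theory Num.Theory.
Import numFieldNormedType.Exports.

Set Implicit Arguments.
Unset Strict Implicit.
Unset Printing Implicit Defensive.

Local Open Scope classical_set_scope.
Local Open Scope ring_scope.

(* The library norm [`|x|] on matrices is the max norm, so the Euclidean norm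
   and its operator norm are defined here; the library topology on ['cV[R]_n]
   is the usual one. *)
Definition euclid_norm (R : realType) (n : nat) (x : 'cV[R]_n) : R :=
  Num.sqrt (\sum_(i < n) x i 0 ^+ 2).

Definition op_norm (R : realType) (n : nat) (A : 'M[R]_n) : R :=
  sup [set euclid_norm (A *m x) | x in [set x : 'cV[R]_n | euclid_norm x <= 1]].

Definition sym_posdef (R : realType) (n : nat) (A : 'M[R]_n) : Prop :=
  A^T = A /\ forall x : 'cV[R]_n, x != 0 -> 0 < (x^T *m A *m x) 0 0.

(* For symmetric [A] and [0 < n] the set of real eigenvalues is finite and
   nonempty, so this infimum and supremum are attained. The library's
   [eigenvalue] uses row eigenvectors, which gives the same spectrum. *)
Definition lambda_min (R : realType) (n : nat) (A : 'M[R]_n) : R :=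
  inf [set a : R | eigenvalue A a].

Definition lambda_max (R : realType) (n : nat) (A : 'M[R]_n) : R :=
  sup [set a : R | eigenvalue A a].

Definition weighted_norm (R : realType) (n : nat) (Q : 'M[R]_n)
    (x : 'cV[R]_n) : R :=
  Num.sqrt ((x^T *m Q *m x) 0 0).

Definition weighted_argmin (R : realType) (n : nat) (S : set 'cV[R]_n)
    (Q : 'M[R]_n) (y : 'cV[R]_n) : set 'cV[R]_n :=
  [set z | S z /\ forall w, S w ->
    2^-1 * weighted_norm Q (z - y) ^+ 2 <= 2^-1 * weighted_norm Q (w - y) ^+ 2].

(* The default value [y] is never reached when [S] is nonempty, closed and
   convex and [Q] is symmetric positive definite: the argmin is then a
   singleton. *)
Definition weighted_proj (R : realType) (n : nat) (S : set 'cV[R]_n)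
    (Q : 'M[R]_n) (y : 'cV[R]_n) : 'cV[R]_n :=
  xget y (weighted_argmin S Q y).

(* Main.v *)
(** Everything is read off the quadratic form [bform Q] of [Q = M(x)^-1].  It is at
    most [L |v|^2] since [|Q| <= L], and Cauchy-Schwarz for this form at [v] and
    [M v] gives [|v|^4 <= Q(v, v) M(v, v) <= Q(v, v) L |v|^2], hence the lower
    bound [L^-1 |v|^2].  These two bounds control the eigenvalues.  The projection
    is nonexpansive for [Q], by adding the two variational inequalities, and
    comparing with the Euclidean norm costs a factor [L].  The last claim is
    [A^-1 - B^-1 = - A^-1 (A - B) B^-1]. *)
Require Import Defs.
From mathcomp Require Import all_boot all_order all_algebra.
From mathcomp Require Import ring lra.
From mathcomp Require Import all_classical all_reals all_analysis.
Set Implicit Arguments.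
Unset Strict Implicit.
Unset Printing Implicit Defensive.
Import Order.TTheory GRing.Theory Num.Theory.
Import numFieldNormedType.Exports.
Local Open Scope classical_set_scope.
Local Open Scope ring_scope.

(** * Bilinear forms of square matrices *)

(** At [A = 1%:M] this is the Euclidean inner product, so Euclidean and weighted norms share one
    calculus. *)
Definition bform {R : realType} {n} (A : 'M[R]_n) (u v : 'cV[R]_n) : R :=
  (u^T *m A *m v) 0 0.

Section BilinearForm.
Context {R : realType} {n : nat}.
Implicit Types (A B : 'M[R]_n) (u v w : 'cV[R]_n).

Lemma bformDl A u v w : bform A (u + v) w = bform A u w + bform A v w.
Proof. by rewrite /bform linearD !mulmxDl mxE. Qed.

Lemma bformDr A u v w : bform A w (u + v) = bform A w u + bform A w v.
Proof. by rewrite /bform mulmxDr mxE. Qed.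

Lemma bformZl A (a : R) u v : bform A (a *: u) v = a * bform A u v.
Proof. by rewrite /bform linearZ /= -!scalemxAl mxE. Qed.

Lemma bformZr A (a : R) u v : bform A u (a *: v) = a * bform A u v.
Proof. by rewrite /bform -scalemxAr mxE. Qed.

Lemma bform0l A u : bform A 0 u = 0.
Proof. by rewrite -[0](scale0r u) bformZl mul0r. Qed.

Lemma bformNl A u v : bform A (- u) v = - bform A u v.
Proof. by rewrite -scaleN1r bformZl mulN1r. Qed.

Lemma bformNr A u v : bform A u (- v) = - bform A u v.
Proof. by rewrite -scaleN1r bformZr mulN1r. Qed.

Lemma bformB A B u v : bform (A - B) u v = bform A u v - bform B u v.
Proof. by rewrite /bform mulmxBr mulmxBl mxE [X in _ + X]mxE. Qed.

Lemma bformZ (a : R) A u v : bform (a *: A) u v = a * bform A u v.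
Proof. by rewrite /bform -scalemxAr -scalemxAl mxE. Qed.

Lemma bform_mulr A B u v : bform A u (B *m v) = bform (A *m B) u v.
Proof. by rewrite /bform !mulmxA. Qed.

Lemma bform_mull A B u v : bform A (B *m u) v = bform (B^T *m A) u v.
Proof. by rewrite /bform trmx_mul !mulmxA. Qed.

Lemma bformC A u v : A^T = A -> bform A u v = bform A v u.
Proof.
move=> sA; rewrite /bform.
have -> : u^T *m A *m v = (v^T *m A *m u)^T by rewrite !trmx_mul trmxK sA mulmxA.
by rewrite mxE.
Qed.

Lemma bformE A u v : bform A u v = \sum_i \sum_j u i 0 * A i j * v j 0.
Proof.
rewrite /bform mxE exchange_big /=; apply: eq_bigr => j _.
by rewrite mxE big_distrl /=; apply: eq_bigr => i _; rewrite mxE.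
Qed.

(** With [t] factored out, for [t > 0] the sign of the increment is that of the bracket. *)
Lemma bform_addZ A (t : R) u v : A^T = A ->
  bform A (u + t *: v) (u + t *: v) =
  bform A u u + t * (2 * bform A u v + t * bform A v v).
Proof.
move=> sA; rewrite !(bformDl, bformDr, bformZl, bformZr) (bformC v u sA).
by ring.
Qed.

(* Expand the nonnegative value of the form at [c u - b v] when
   [c = bform A v v] is positive, and at [u + t v] with [t] large when [c = 0]. *)
Lemma bform_CauchySchwarz A u v :
    A^T = A -> (forall x, 0 <= bform A x x) ->
  bform A u v ^+ 2 <= bform A u u * bform A v v.
Proof.
move=> sA A_ge0.
set a := bform A u u; set b := bform A u v; set c := bform A v v.
have vu : bform A v u = b by rewrite bformC.
have expand s t : 0 <= s ^+ 2 * a + 2 * s * t * b + t ^+ 2 * c.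
  have -> : s ^+ 2 * a + 2 * s * t * b + t ^+ 2 * c =
      bform A (s *: u + t *: v) (s *: u + t *: v).
    by rewrite !(bformDl, bformDr, bformZl, bformZr) vu -/a -/b -/c; ring.
  exact: A_ge0.
have c_ge0 : 0 <= c by exact: A_ge0.
have [c0|c_neq0] := eqVneq c 0.
  have [->|b_neq0] := eqVneq b 0; first by rewrite c0 mulr0 expr0n.
  have := expand 1 (- (a + 1) / (2 * b)); rewrite c0 mulr0 addr0.
  have -> : 1 ^+ 2 * a + 2 * 1 * (- (a + 1) / (2 * b)) * b = -1 by field.
  by rewrite ler0N1.
have c_gt0 : 0 < c by rewrite lt_def c_neq0.
have := expand c (- b).
have -> : c ^+ 2 * a + 2 * c * - b * b + (- b) ^+ 2 * c = c * (a * c - b ^+ 2) by ring.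
by rewrite pmulr_rge0 // subr_ge0.
Qed.

End BilinearForm.

(** * Euclidean norm and operator norm *)

Section EuclideanNorm.
Context {R : realType} {n : nat}.
Implicit Types (A B : 'M[R]_n) (u v w x : 'cV[R]_n).

Lemma euclid_norm_ge0 x : 0 <= euclid_norm x.
Proof. exact: sqrtr_ge0. Qed.

Lemma sqr_euclid_norm x : euclid_norm x ^+ 2 = bform 1%:M x x.
Proof.
rewrite sqr_sqrtr; last by apply: sumr_ge0 => i _; exact: sqr_ge0.
rewrite /bform mulmx1 mxE; apply: eq_bigr => i _; by rewrite mxE expr2.
Qed.

Lemma bform1_ge0 x : 0 <= bform 1%:M x x.
Proof. by rewrite -sqr_euclid_norm sqr_ge0. Qed.

Lemma euclid_norm_eq0 x : (euclid_norm x == 0) = (x == 0).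
Proof.
apply/idP/eqP => [|->]; last first.
  by rewrite -sqrf_eq0 sqr_euclid_norm bform0l.
rewrite -sqrf_eq0 sqr_sqrtr; last by apply: sumr_ge0 => i _; exact: sqr_ge0.
rewrite psumr_eq0 => [/allP x0|i _]; last exact: sqr_ge0.
apply/matrixP => i j; rewrite ord1 mxE; apply/eqP.
by rewrite -sqrf_eq0; apply: x0; rewrite mem_index_enum.
Qed.

Lemma euclid_norm_gt0 x : x != 0 -> 0 < euclid_norm x.
Proof. by move=> x0; rewrite lt_def euclid_norm_eq0 x0 euclid_norm_ge0. Qed.

Lemma euclid_normZ (a : R) x : euclid_norm (a *: x) = `|a| * euclid_norm x.
Proof.
apply/eqP; rewrite -(@eqrXn2 _ 2) ?euclid_norm_ge0 ?mulr_ge0 ?euclid_norm_ge0 //.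
by rewrite exprMn !sqr_euclid_norm bformZl bformZr mulrA real_normK ?num_real.
Qed.

Lemma normr_coord_le x i : `|x i 0| <= euclid_norm x.
Proof.
rewrite -sqrtr_sqr ler_sqrt; last by apply: sumr_ge0 => k _; exact: sqr_ge0.
by rewrite (bigD1 i) //= lerDl; apply: sumr_ge0 => k _; exact: sqr_ge0.
Qed.

Lemma bform1_le u v : bform 1%:M u v <= euclid_norm u * euclid_norm v.
Proof.
apply: le_trans (ler_norm _) _.
rewrite -(@ler_pXn2r _ 2) ?nnegrE ?mulr_ge0 ?euclid_norm_ge0 //.
rewrite real_normK ?num_real // exprMn !sqr_euclid_norm.
by apply: bform_CauchySchwarz; [exact: trmx1|exact: bform1_ge0].
Qed.

(** Each [|x j 0|] is at most the norm of [x], so coordinate [i] of [A *m x] is at most the absolute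
    sum of row [i] times that norm. This makes the supremum in [op_norm] one of a bounded set. *)
Lemma euclid_norm_mulmx_bounded A :
  exists2 C, 0 <= C & forall x, euclid_norm (A *m x) <= C * euclid_norm x.
Proof.
exists (Num.sqrt (\sum_i (\sum_j `|A i j|) ^+ 2)) => [|x]; first exact: sqrtr_ge0.
rewrite -[euclid_norm x]ger0_norm ?euclid_norm_ge0 // -sqrtr_sqr -sqrtrM; last first.
  by apply: sumr_ge0 => i _; exact: sqr_ge0.
apply: ler_wsqrtr; rewrite big_distrl /=; apply: ler_sum => i _.
rewrite -exprMn -real_normK ?num_real // ler_pXn2r ?nnegrE //; last first.
  by rewrite mulr_ge0 ?euclid_norm_ge0 // sumr_ge0.
rewrite mxE (le_trans (ler_norm_sum _ _ _)) // big_distrl /=.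
by apply: ler_sum => j _; rewrite normrM ler_wpM2l // normr_coord_le.
Qed.

(** By homogeneity, evaluate at the unit vector along [x], a member of the bounded set whose
    supremum is [op_norm A]. *)
Lemma euclid_norm_mulmx_le A x :
  euclid_norm (A *m x) <= op_norm A * euclid_norm x.
Proof.
have [->|x0] := eqVneq x 0.
  have z : euclid_norm (0 : 'cV[R]_n) = 0 by apply/eqP; rewrite euclid_norm_eq0.
  by rewrite mulmx0 z mulr0.
rewrite -ler_pdivrMr ?euclid_norm_gt0 //.
have [C C_ge0 AC] := euclid_norm_mulmx_bounded A.
apply: ub_le_sup.
  exists C => _ [y /= y1 <-]; apply: le_trans (AC y) _.
  by rewrite ler_piMr.
exists ((euclid_norm x)^-1 *: x) => /=.
  by rewrite euclid_normZ ger0_norm ?invr_ge0 ?euclid_norm_ge0 // mulVf // euclid_norm_eq0.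
by rewrite -scalemxAr euclid_normZ ger0_norm ?invr_ge0 ?euclid_norm_ge0 // mulrC.
Qed.

Lemma op_norm_le A (C : R) : 0 <= C ->
  (forall x, euclid_norm (A *m x) <= C * euclid_norm x) -> op_norm A <= C.
Proof.
move=> C_ge0 AC; apply: ge_sup.
  (* [ge_sup] needs a nonempty set; the zero vector lies in the unit ball. *)
  exists (euclid_norm (A *m 0)), 0 => //=.
  by rewrite (le_trans _ ler01) // le_eqVlt euclid_norm_eq0 eqxx.
by move=> _ [y /= y1 <-]; apply: le_trans (AC y) _; rewrite ler_piMr.
Qed.

(** The form is the inner product of [x] and [A *m x], to which Cauchy-Schwarz applies. *)
Lemma bform_le_op_norm A x : bform A x x <= op_norm A * euclid_norm x ^+ 2.
Proof.
rewrite -[A]mul1mx -bform_mulr mul1mx (le_trans (bform1_le _ _)) //.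
by rewrite expr2 mulrA [leRHS]mulrC ler_wpM2l ?euclid_norm_ge0 ?euclid_norm_mulmx_le.
Qed.

End EuclideanNorm.

(** * Compactness, and an eigenvalue of a symmetric matrix *)

(** Carries the compactness of boxes from row vectors, where [rV_compact] gives it, to column
    vectors. *)
Lemma trmx_continuous {R : realType} m n :
  continuous (trmx : 'M[R]_(m, n) -> 'M[R]_(n, m)).
Proof.
move=> A B /nbhs_ballP[e e_gt0 AeB]; apply/nbhs_ballP; exists e => // C [e0 AC].
by apply: AeB; split => // i j; rewrite !mxE.
Qed.

Section EuclideanTopology.
Context {R : realType} {n : nat}.
Implicit Types (A : 'M[R]_n) (y : 'cV[R]_n) (K : set 'cV[R]_n).

(** The form is a polynomial in the coordinates. The centre [y] serves the projection objective;
    [y = 0] serves the unit sphere. *)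
Lemma bform_sub_continuous A y : continuous (fun x : 'cV[R]_n => bform A (x - y) (x - y)).
Proof.
under eq_fun do rewrite bformE.
apply: (@continuous_big _ _ _ _ _ (fun i x => _)) => [|i _]; first exact: add_continuous.
apply: (@continuous_big _ _ _ _ _ (fun j x => _)) => [|j _]; first exact: add_continuous.
have coord k : continuous (fun x : 'cV[R]_n => (x - y) k 0).
  under eq_fun do rewrite mxE [X in _ + X]mxE.
  by move=> x; exact: (cvgB (@coord_continuous R n 1 k 0 x) (cvg_cst _)).
by move=> x; exact: (cvgM (cvgM (coord i x) (cvg_cst _)) (coord j x)).
Qed.

(** Each coordinate of a point of [K] is within [C] of that of [y], so [K] is a closed subset of a
    transposed compact box. *)
Lemma closed_euclid_bounded_compact K y (C : R) :
  closed K -> (forall x, K x -> euclid_norm (x - y) <= C) -> compact K.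
Proof.
move=> K_closed K_bounded.
pose box i := `[y i 0 - C, y i 0 + C]%classic.
have box_compact : compact [set v : 'rV[R]_n | forall i, box i (v ord0 i)].
  by apply: rV_compact => i; exact: segment_compact.
have := continuous_compact (continuous_subspaceT (@trmx_continuous R 1 n)) box_compact.
move/(subclosed_compact K_closed); apply => x Kx /=.
exists x^T; last exact: trmxK.
move=> i /=; rewrite mxE /box /= in_itv /= -ler_distl.
have := normr_coord_le (x - y) i; rewrite !mxE => /le_trans; apply.
exact: K_bounded.
Qed.

End EuclideanTopology.
Arguments bform_sub_continuous {R n} A y : rename.

(* A minimizer of the Rayleigh quotient on the unit sphere is an eigenvector: it
   is isotropic for the positive semidefinite form [A - mu], hence in its kernel
   by the Cauchy-Schwarz inequality. *)
Lemma symmetric_eigenvalue_exists (R : realType) n (A : 'M[R]_n) :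
  (0 < n)%N -> A^T = A -> exists a, eigenvalue A a.
Proof.
move=> n_gt0 sA.
(* The shape [x - 0] matches [bform_sub_continuous], which yields closedness. *)
pose sphere := [set x : 'cV[R]_n | bform 1%:M (x - 0) (x - 0) = 1].
have sphereE x : sphere x = (euclid_norm x = 1).
  rewrite /sphere /= subr0 -sqr_euclid_norm; apply/propext; split => [/eqP|->]; last exact: expr1n.
  by rewrite sqrf_eq1 => /orP[/eqP//|/eqP x_N1]; have := euclid_norm_ge0 x; rewrite x_N1 ler0N1.
have normalize (x : 'cV[R]_n) : x != 0 -> sphere ((euclid_norm x)^-1 *: x).
  move=> x0; rewrite sphereE euclid_normZ ger0_norm ?invr_ge0 ?euclid_norm_ge0 //.
  by rewrite mulVf // euclid_norm_eq0.
have sphere_nonempty : sphere !=set0.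
  pose e : 'cV[R]_n := const_mx 1.
  exists ((euclid_norm e)^-1 *: e); apply: normalize.
  by apply/eqP => /matrixP/(_ (Ordinal n_gt0) 0)/eqP; rewrite !mxE oner_eq0.
have sphere_compact : compact sphere.
  apply: (@closed_euclid_bounded_compact _ _ _ 0 1) => [|x]; last first.
    by rewrite sphereE subr0 => ->.
  have /continuous_closedP form_closed := bform_sub_continuous (1%:M : 'M[R]_n) 0.
  exact: (form_closed _ (@closed_eq R 1)).
have [x x1 x_min] : exists2 x : 'cV[R]_n, euclid_norm x = 1 &
    forall u, sphere u -> bform A x x <= bform A u u.
  have [x /set_mem] := compact_EVT_min sphere_nonempty sphere_compact
    (continuous_subspaceT (bform_sub_continuous A 0)).
  rewrite sphereE => x1 x_min; exists x => // u /mem_set/x_min.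
  by rewrite !subr0.
pose mu := bform A x x; pose B : 'M[R]_n := A - mu *: 1%:M.
have BE u : bform B u u = bform A u u - mu * euclid_norm u ^+ 2.
  by rewrite bformB bformZ sqr_euclid_norm.
have B_ge0 u : 0 <= bform B u u.
  have [->|u0] := eqVneq u 0; first by rewrite bform0l.
  have := x_min _ (normalize u u0).
  rewrite bformZl bformZr mulrA -expr2 exprVn -/mu.
  by rewrite ler_pdivlMl ?exprn_gt0 ?euclid_norm_gt0 // BE subr_ge0 mulrC.
have sB : B^T = B by rewrite linearB /= linearZ /= trmx1 sA.
have Bx : B *m x = 0.
  have := bform_CauchySchwarz x (B *m x) sB B_ge0.
  have -> : bform B x (B *m x) = euclid_norm (B *m x) ^+ 2.
    by rewrite sqr_euclid_norm bform_mull mulmx1 sB.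
  rewrite BE x1 expr1n mulr1 subrr mul0r => Bx_le0.
  by apply/eqP; rewrite -euclid_norm_eq0 -sqrf_eq0 -sqrf_eq0 eq_le Bx_le0 sqr_ge0.
exists mu; apply/eigenvalueP; exists x^T; last first.
  by rewrite trmx_eq0 -euclid_norm_eq0 x1 oner_eq0.
have /eqP : A *m x - mu *: x = 0.
  by rewrite -Bx mulmxBl -scalemxAl mul1mx.
rewrite subr_eq0 => /eqP Ax.
by rewrite -{1}sA -trmx_mul Ax linearZ.
Qed.

(** * Positive definite forms and the weighted projection *)

Section PositiveDefinite.
Context {R : realType} {n : nat}.
Implicit Types (A Q : 'M[R]_n) (u v w x y z : 'cV[R]_n) (S : set 'cV[R]_n).

Lemma sym_posdef_form_ge0 A x : sym_posdef A -> 0 <= bform A x x.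
Proof.
case=> _ A_gt0; have [->|x0] := eqVneq x 0; first by rewrite bform0l.
exact/ltW/A_gt0.
Qed.

(** A nonzero row [v] with [v *m A = 0] would make the form vanish at [v^T]. *)
Lemma sym_posdef_unitmx A : sym_posdef A -> A \in unitmx.
Proof.
case=> sA A_gt0; rewrite -row_free_unit -kermx_eq0; apply/negPn/negP => /rowV0Pn[v].
move=> /sub_kermxP vA v0; have := A_gt0 v^T.
by rewrite trmxK vA mul0mx mxE ltxx trmx_eq0 v0 => /(_ isT).
Qed.

(** The form of [invmx A] at [x] equals that of [A] at [invmx A *m x]. *)
Lemma invmx_sym_posdef A : sym_posdef A -> sym_posdef (invmx A).
Proof.
move=> pA; have uA := sym_posdef_unitmx pA; case: (pA) => sA A_gt0.
have sQ : (invmx A)^T = invmx A by rewrite trmx_inv sA.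
split=> // x x0; have := A_gt0 (invmx A *m x).
rewrite trmx_mul sQ !mulmxA mulmxKV // => -> //.
by apply: contra_neq x0 => Qx; rewrite -[x](mulKVmx uA) Qx mulmx0.
Qed.

(* Cauchy-Schwarz for the form of [A^-1] at [x] and [A x], whose pairing is
   [|x|^2]. *)
Lemma invmx_form_lower_bound A (L : R) x :
    sym_posdef A -> 1 <= L -> op_norm A <= L ->
  L^-1 * euclid_norm x ^+ 2 <= bform (invmx A) x x.
Proof.
move=> pA L_ge1 A_le; have uA := sym_posdef_unitmx pA.
have L_gt0 : 0 < L by exact: lt_le_trans ltr01 L_ge1.
have pQ := invmx_sym_posdef pA; have [sQ _] := pQ; have [sA _] := pA.
rewrite ler_pdivrMl //.
have [->|x0] := eqVneq x 0.
  by rewrite sqr_euclid_norm !bform0l mulr0.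
have x2_gt0 : 0 < euclid_norm x ^+ 2 by rewrite exprn_gt0 ?euclid_norm_gt0.
rewrite -(ler_pM2r x2_gt0) -expr2.
have := bform_CauchySchwarz x (A *m x) sQ (fun y => sym_posdef_form_ge0 y pQ).
rewrite (bform_mull _ A) sA mulmxV // !bform_mulr mulVmx // mul1mx -sqr_euclid_norm.
move=> /le_trans; apply; rewrite [L * _]mulrC -mulrA ler_wpM2l //.
  exact: sym_posdef_form_ge0.
by rewrite (le_trans (bform_le_op_norm _ _)) // ler_wpM2r // ltW.
Qed.

Lemma sqr_weighted_norm Q x : sym_posdef Q -> weighted_norm Q x ^+ 2 = bform Q x x.
Proof. by move=> pQ; rewrite sqr_sqrtr //; exact: sym_posdef_form_ge0. Qed.

Lemma weighted_argminE S Q y z : sym_posdef Q ->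
  weighted_argmin S Q y z <->
  S z /\ forall w, S w -> bform Q (z - y) (z - y) <= bform Q (w - y) (w - y).
Proof.
move=> pQ; rewrite /weighted_argmin /=.
by split=> -[Sz z_min]; split=> // w /z_min; rewrite !sqr_weighted_norm // ler_pM2l ?invr_gt0.
Qed.

(** The sublevel set through a point [w] of [S] is closed, and coercivity puts it in the ball of
    radius [Num.sqrt (c^-1 * r)] about [y]. A minimizer on this compact set is global, since points
    of [S] outside it have values above [r]. *)
Lemma weighted_argmin_exists S Q y (c : R) :
    S !=set0 -> closed S -> sym_posdef Q -> 0 < c ->
    (forall x, c * euclid_norm x ^+ 2 <= bform Q x x) ->
  weighted_argmin S Q y !=set0.
Proof.
move=> [w Sw] S_closed pQ c_gt0 Q_ge.
pose r := bform Q (w - y) (w - y).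
pose K := S `&` [set x | bform Q (x - y) (x - y) <= r].
have K_closed : closed K.
  have /continuous_closedP form_closed := bform_sub_continuous Q y.
  exact: closedI S_closed (form_closed _ (@closed_le R r)).
have K_compact : compact K.
  apply: (@closed_euclid_bounded_compact _ _ _ y (Num.sqrt (c^-1 * r))) => // x [_ x_le].
  rewrite -[leLHS]ger0_norm ?euclid_norm_ge0 // -sqrtr_sqr ler_wsqrtr //.
  by rewrite ler_pdivlMl // (le_trans (Q_ge _)).
have Kw : K w by split => //=.
have [z /set_mem[Sz z_le] z_min] := compact_EVT_min (ex_intro _ w Kw) K_compact
  (continuous_subspaceT (bform_sub_continuous Q y)).
exists z; apply/weighted_argminE => //; split=> // x Sx.
have [x_le|/ltW] := leP (bform Q (x - y) (x - y)) r; last exact: le_trans.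
by apply: z_min; rewrite inE.
Qed.

(** If the pairing were negative, a short move from [z] towards [w] would stay in [S] and decrease
    the objective. *)
Lemma weighted_argmin_variational S Q y z w :
    convex_set S -> sym_posdef Q -> weighted_argmin S Q y z -> S w ->
  0 <= bform Q (z - y) (w - z).
Proof.
move=> S_convex pQ /(weighted_argminE _ _ _ pQ)[Sz z_min] Sw.
have [sQ _] := pQ.
set a := bform Q (z - y) (w - z); set b := bform Q (w - z) (w - z).
have b_ge0 : 0 <= b by exact: sym_posdef_form_ge0.
rewrite leNgt; apply/negP => a_lt0.
have ba_gt0 : 0 < b - a by lra.
(* This step lies in [(0, 1]] as [a < 0 <= b], and gives [2 * a + t * b = a * (b - 2 * a) / (b - a)
   < 0], so the objective drops. *)
pose t := - a / (b - a).
have t_gt0 : 0 < t by rewrite divr_gt0 ?oppr_gt0.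
have t_le1 : t <= 1 by rewrite ler_pdivrMr // mul1r lerDr.
have := z_min _ (set_mem (S_convex w z (Itv01 (ltW t_gt0) t_le1) (mem_set Sw) (mem_set Sz))).
have -> : conv (Itv01 (ltW t_gt0) t_le1) (w : convex_lmodType _) z - y = (z - y) + t *: (w - z).
  rewrite /conv /= /unstable.onem.
  by apply/matrixP => i j; rewrite !mxE; ring.
rewrite bform_addZ // -/a -/b lerDl pmulr_rge0 // leNgt => /negP; apply.
have -> : 2 * a + t * b = a * (b - 2 * a) / (b - a) by rewrite /t; field; rewrite gt_eqF.
by rewrite pmulr_llt0 ?invr_gt0 // nmulr_rlt0 //; lra.
Qed.

Lemma weighted_argmin_nonexpansive S Q y1 y2 z1 z2 :
    convex_set S -> sym_posdef Q ->
    weighted_argmin S Q y1 z1 -> weighted_argmin S Q y2 z2 ->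
  bform Q (z1 - z2) (z1 - z2) <= bform Q (y1 - y2) (y1 - y2).
Proof.
move=> S_convex pQ z1_min z2_min; have [sQ _] := pQ.
have [[Sz1 _] [Sz2 _]] := (z1_min, z2_min).
have := weighted_argmin_variational S_convex pQ z1_min Sz2.
have := weighted_argmin_variational S_convex pQ z2_min Sz1.
have := bform_CauchySchwarz (z1 - z2) (y1 - y2) sQ (fun x => sym_posdef_form_ge0 x pQ).
have := sym_posdef_form_ge0 (z1 - z2) pQ; have := sym_posdef_form_ge0 (y1 - y2) pQ.
set e := bform Q (y1 - y2) (y1 - y2); set d := bform Q (z1 - z2) (z1 - z2).
set f := bform Q (z1 - z2) (y1 - y2) => e_ge0 d_ge0 cs v2 v1.
(* The difference [f - d] is exactly the sum of the two nonnegative pairings [v1] and [v2]. *)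
have d_le : d <= f.
  have -> : f = d + bform Q (z1 - y1) (z2 - z1) + bform Q (z2 - y2) (z1 - z2).
    rewrite /f /d !(bformDl, bformDr, bformNl, bformNr).
    rewrite (bformC z2 z1 sQ) (bformC y1 z1 sQ) (bformC y1 z2 sQ) (bformC y2 z1 sQ) (bformC y2 z2 sQ).
    by ring.
  by rewrite -addrA lerDl addr_ge0.
have [d0|d_neq0] := eqVneq d 0; first by rewrite d0.
have d_gt0 : 0 < d by rewrite lt_def d_neq0.
(* Cancel [d] in [d ^+ 2 <= f ^+ 2 <= d * e]. *)
rewrite -(ler_pM2l d_gt0) (le_trans _ cs) // -expr2 ler_pXn2r ?nnegrE //.
exact: le_trans d_le.
Qed.

End PositiveDefinite.

(** * Eigenvalue bounds and perturbation of the inverse *)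

(** At the transpose of a row eigenvector the form is [a] times the squared norm, which is positive
    and cancels. *)
Lemma eigenvalue_form_bounds (R : realType) n (A : 'M[R]_n) (l u a : R) :
    (forall x, l * euclid_norm x ^+ 2 <= bform A x x <= u * euclid_norm x ^+ 2) ->
  eigenvalue A a -> l <= a <= u.
Proof.
move=> A_bounds /eigenvalueP[v vA v0].
have v2_gt0 : 0 < euclid_norm v^T ^+ 2.
  by rewrite exprn_gt0 // euclid_norm_gt0 // trmx_eq0.
have := A_bounds v^T.
have -> : bform A v^T v^T = a * euclid_norm v^T ^+ 2.
  by rewrite sqr_euclid_norm /bform !trmxK vA mulmx1 -scalemxAl mxE.
by rewrite !ler_pM2r.
Qed.

Lemma op_norm_invmx_sub_le (R : realType) n (A B : 'M[R]_n) (L K : R) :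
    A \in unitmx -> B \in unitmx -> op_norm (invmx A) <= L -> op_norm (invmx B) <= L ->
    0 <= L -> 0 <= K -> op_norm (A - B) <= K ->
  op_norm (invmx A - invmx B) <= L ^+ 2 * K.
Proof.
move=> uA uB A_le B_le L_ge0 K_ge0 AB_le.
have -> : invmx A - invmx B = - (invmx A *m ((A - B) *m invmx B)).
  rewrite mulmxBl mulmxBr mulmxA mulVmx // mul1mx mulmxV // mulmx1.
  by rewrite opprB.
have mulmx_bound C c (x : 'cV[R]_n) d : op_norm C <= c -> 0 <= c -> euclid_norm x <= d ->
    euclid_norm (C *m x) <= c * d.
  move=> C_le c_ge0 x_le; rewrite (le_trans (euclid_norm_mulmx_le _ _)) //.
  rewrite (le_trans (ler_wpM2r (euclid_norm_ge0 x) C_le)) //.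
  exact: ler_wpM2l.
apply: op_norm_le => [|x]; first by rewrite mulr_ge0 // exprn_ge0.
(* The constant is reordered as [L * (K * (L * _))], to match the three factors from the outside
   in. *)
rewrite mulNmx -scaleN1r euclid_normZ normrN1 mul1r -!mulmxA expr2 [L * L * K]mulrAC -!mulrA.
by do 3!apply: (mulmx_bound) => //.
Qed.

(** * Uniform bounds over [S] *)

Unset Implicit Arguments.

Theorem corollary5 (R : realType) (n : nat) (n_gt0 : (0 < n)%N)
    (S : set 'cV[R]_n)
    (S_nonempty : S !=set0) (S_closed : closed S) (S_convex : convex_set S)
    (M : 'cV[R]_n -> 'M[R]_n)
    (M_posdef : forall x, sym_posdef (M x))
    (L : R) (L_ge1 : 1 <= L)
    (M_bound : forall x, S x -> op_norm (M x) <= L)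
    (Minv_bound : forall x, S x -> op_norm (invmx (M x)) <= L) :
  let Q := fun x => invmx (M x) in
  (forall x, S x ->
     [/\ L^-1 <= lambda_min (Q x),
         lambda_max (Q x) <= L
       & forall z1 z2 : 'cV[R]_n,
           euclid_norm (weighted_proj S (Q x) z1 - weighted_proj S (Q x) z2)
             <= L * euclid_norm (z1 - z2)])
  /\
  (forall K_M : R, 0 <= K_M ->
     (forall x y, S x -> S y ->
        op_norm (M x - M y) <= K_M * euclid_norm (x - y)) ->
     forall x y, S x -> S y ->
       op_norm (invmx (M x) - invmx (M y))
         <= L ^+ 2 * K_M * euclid_norm (x - y)).
Proof.
move=> Q; have L_gt0 : 0 < L by exact: lt_le_trans ltr01 L_ge1.
split=> [x Sx|K K_ge0 M_lip x y Sx Sy]; last first.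
  rewrite -mulrA; apply: op_norm_invmx_sub_le; rewrite ?sym_posdef_unitmx //.
  - exact: Minv_bound.
  - exact: Minv_bound.
  - exact: ltW.
  - by rewrite mulr_ge0 ?euclid_norm_ge0.
  - exact: M_lip.
have pQ : sym_posdef (Q x) by exact: invmx_sym_posdef.
have Q_lower v : L^-1 * euclid_norm v ^+ 2 <= bform (Q x) v v.
  by apply: invmx_form_lower_bound => //; exact: M_bound.
have Q_upper v : bform (Q x) v v <= L * euclid_norm v ^+ 2.
  by rewrite (le_trans (bform_le_op_norm _ _)) // ler_wpM2r ?sqr_ge0 ?Minv_bound.
have eigen_bounds a : eigenvalue (Q x) a -> L^-1 <= a <= L.
  by apply: eigenvalue_form_bounds => v; rewrite Q_lower Q_upper.
(* Here [n_gt0] enters: without an eigenvalue the infimum and supremum would be default values. *)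
have eigen_nonempty : [set a | eigenvalue (Q x) a] !=set0.
  by have [sQ _] := pQ; exact: symmetric_eigenvalue_exists.
split=> [||z1 z2].
- by apply: lb_le_inf => // a /eigen_bounds/andP[].
- by apply: ge_sup => // a /eigen_bounds/andP[].
(* Existence of a minimizer rules out the default value of [xget]. *)
have argminP z : weighted_argmin S (Q x) z (weighted_proj S (Q x) z).
  have LV_gt0 : 0 < L^-1 by rewrite invr_gt0.
  apply: xgetPex; exact: (weighted_argmin_exists z S_nonempty S_closed pQ LV_gt0 Q_lower).
have := weighted_argmin_nonexpansive S_convex pQ (argminP z1) (argminP z2).
(* Sandwiching the [Q x]-contraction gives [L^-1] times one squared norm at most [L] times the
   other; the factor [L ^+ 2] becomes [L] after taking roots. *)
move=> /(le_trans (Q_lower _))/le_trans/(_ (Q_upper _)).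
rewrite ler_pdivrMl // mulrA -expr2 -exprMn.
by rewrite ler_pXn2r // nnegrE ?mulr_ge0 ?euclid_norm_ge0 // ltW.
Qed.
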